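(* Let $P=(v_0,\dots,v_\ell)$ be a path, $s=v_0$, and $t\in V(P)$. Then the two-rooted graph $(P,s,t)$ is not inherent if one of the following holds: (i) $\ell\ge 1$ and $t=v_0$; (ii) $\ell\ge 3$ and $t=v_{\ell-1}$; (iii) $\ell=3$ and $t=v_1$; (iv) $\ell=4$ and $t=v_1$; (v) $\ell=5$ and $t=v_2$.
   Context: All graphs are finite, simple and undirected. A two-rooted graph is a triple $(H,s,t)$ where $H$ is a graph and $s,t\in V(H)$ are not necessarily distinct. A copy of a two-rooted graph $(\hat H,\hat s,\hat t)$ in a graph $G$ is a two-rooted graph $(H,s,t)$ such that $H$ is an induced subgraph of $G$ and some isomorphism $\hat H\to H$ maps $\hat s\mapsto s$, $\hat t\mapsto t$. An extension of a copy $(H,s,t)$ in $G$ is a two-rooted graph $(H',s',t')$ with $H'$ an induced subgraph of $G$, $V(H')=V(H)\cup\{s',t'\}$, $s'\neq t'$, $s',t'\notin V(H)$, $H'-\{s',t'\}=H$, and $s$ (resp. $t$) the unique neighbour of $s'$ (resp. $t'$) in $H'$. The extension is closable if there is an induced $s',t'$-path in $G$ all of whose internal vertices lie outside $N_G[V(H)]$. A copy is avoidable if all its extensions in $G$ are closable. $(\hat H,\hat s,\hat t)$ is inherent if every graph $G$ containing an induced subgraph isomorphic to $\hat H$ also contains an avoidable copy of $(\hat H,\hat s,\hat t)$. *)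

(* Defs.v *)
From mathcomp Require Import all_boot.

Set Implicit Arguments.
Unset Strict Implicit.
Unset Printing Implicit Defensive.

Record sgraph := SGraph {
  vertex :> finType;
  adj : rel vertex;
  adj_sym : symmetric adj;
  adj_irrefl : irreflexive adj
}.

Definition graph_iso (G H : sgraph) (f : G -> H) : Prop :=
  bijective f /\ forall x y : G, adj (f x) (f y) = adj x y.

Section Induced.
Variables (G : sgraph) (S : {set G}).

Definition induced_adj : rel {x : G | x \in S} :=
  fun x y => adj (val x) (val y).

Lemma induced_adj_sym : symmetric induced_adj.
Proof. by move=> x y; apply: adj_sym. Qed.

Lemma induced_adj_irrefl : irreflexive induced_adj.
Proof. by move=> x; apply: adj_irrefl. Qed.

Definition induced : sgraph := SGraph induced_adj_sym induced_adj_irrefl.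
End Induced.

Section PathGraph.
Variable n : nat.

Definition path_adj : rel 'I_n.+1 :=
  fun i j => (i.+1 == j :> nat) || (j.+1 == i :> nat).

Lemma path_adj_sym : symmetric path_adj.
Proof. by move=> i j; rewrite /path_adj orbC. Qed.

Lemma path_adj_irrefl : irreflexive path_adj.
Proof. by move=> i; rewrite /path_adj orbb gtn_eqF. Qed.

(* Here n counts edges: path_graph n has the n.+1 vertices 0, ..., n. *)
Definition path_graph : sgraph := SGraph path_adj_sym path_adj_irrefl.
End PathGraph.

Definition closed_nbhd (G : sgraph) (X : {set G}) : {set G} :=
  [set x | (x \in X) || [exists y in X, adj y x]].

Record two_rooted := TwoRooted {
  tr_graph : sgraph;
  tr_s : tr_graph;
  tr_t : tr_graph
}.

Definition two_rooted_iso (H K : two_rooted) : Prop :=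
  exists f : tr_graph H -> tr_graph K,
    [/\ graph_iso f, f (tr_s H) = tr_s K & f (tr_t H) = tr_t K].

(* A two-rooted graph whose underlying graph is an induced subgraph of G. *)
Record rooted_sub (G : sgraph) := RootedSub {
  rs_set : {set G};
  rs_s : induced rs_set;
  rs_t : induced rs_set
}.

Definition rooted_sub_graph (G : sgraph) (H : rooted_sub G) : two_rooted :=
  TwoRooted (rs_s H) (rs_t H).

Definition is_copy (Hhat : two_rooted) (G : sgraph) (H : rooted_sub G) : Prop :=
  two_rooted_iso Hhat (rooted_sub_graph H).

(* The neighbours of s' and t' are taken in H', so s' and t' are nonadjacent.
   H' - {s', t'} = H is implied, as both are induced subgraphs of G. *)
Definition is_extension (G : sgraph) (H H' : rooted_sub G) : Prop :=
  let s' := rs_s H' in let t' := rs_t H' in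
  [/\ rs_set H' = rs_set H :|: [set val s'; val t'],
      s' != t',
      val s' \notin rs_set H /\ val t' \notin rs_set H,
      forall x : induced (rs_set H'), adj s' x = (val x == val (rs_s H))
    & forall x : induced (rs_set H'), adj t' x = (val x == val (rs_t H))].

Definition closable (G : sgraph) (H H' : rooted_sub G) : Prop :=
  exists (n : nat) (Q : {set G}) (p : path_graph n -> induced Q),
    [/\ graph_iso p,
        val (p ord0) = val (rs_s H'),
        val (p ord_max) = val (rs_t H')
      & forall i : 'I_n.+1, 0 < i < n ->
          val (p i) \notin closed_nbhd (rs_set H)].

Definition avoidable (G : sgraph) (H : rooted_sub G) : Prop :=
  forall H' : rooted_sub G, is_extension H H' -> closable H H'.

Definition contains_induced (G H : sgraph) : Prop :=
  exists (S : {set G}) (f : H -> induced S), graph_iso f.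

Definition inherent (Hhat : two_rooted) : Prop :=
  forall G : sgraph, contains_induced G (tr_graph Hhat) ->
    exists2 H : rooted_sub G, is_copy Hhat H & avoidable H.

(* Main.v *)
(* A graph G refutes inherence as soon as it contains the path and every copy
   of it has an extension in which s' is separated from t' by the closed
   neighbourhood of the copy.
   - For (i) with l <> 2 and for (ii), G is the cycle C_(l+3) with every vertex
     doubled into two nonadjacent twins. A copy contains no twins, hence winds
     around the cycle in one direction and misses two fibres; take s' in the
     fibre before v_0, so that every neighbour of s' is adjacent to v_1 or v_l,
     and let t' be the twin of s' in case (i) and the twin of v_l in case (ii).
   - For (i) with l = 2 and for (iii), G is the Petersen graph.
   - For (iv) and (v), G is the Heawood graph. *)

Require Import Defs.
From mathcomp Require Import all_boot all_algebra zify.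

Import GRing.Theory.

Set Implicit Arguments.
Unset Strict Implicit.
Unset Printing Implicit Defensive.

(** * A trap for every induced path refutes inherence *)

Section Criterion.
Variables (G : sgraph) (l : nat).
Implicit Types (q : 'I_l.+1 -> G) (j : 'I_l.+1) (a b x y : G).

Definition induced_path q : Prop :=
  injective q /\ forall i k, adj (q i) (q k) = path_adj i k.

Definition path_nbhd q : {set G} := closed_nbhd [set q i | i : 'I_l.+1].

Lemma path_nbhdP q y :
  reflect (exists i, (q i == y) || adj (q i) y) (y \in path_nbhd q).
Proof.
rewrite inE; apply: (iffP orP) => [[/imsetP[i _ ->]|/exists_inP[x /imsetP[i _ ->] xy]]|].
- by exists i; rewrite eqxx.
- by exists i; rewrite xy orbT.
case=> i /orP[/eqP <-|qy]; first by left; apply: imset_f.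
by right; apply/exists_inP; exists (q i) => //; apply: imset_f.
Qed.

Definition root_nbr q j a : Prop :=
  forall i, (a == q i) = false /\ adj a (q i) = (i == j).

(* The path together with a and b (in the roles of s' and t') is an extension,
   and C contains every vertex that can be reached from a while avoiding the
   closed neighbourhood of the path. *)
Definition trapped q j : Prop := exists a b (C : pred G),
  [/\ root_nbr q ord0 a, root_nbr q j b, a != b /\ adj a b = false,
      C a /\ ~~ C b &
      forall x y, C x -> adj x y -> (y != b) && (C y || (y \in path_nbhd q))].

(** A path closing the extension would start at a in C and, by induction along it, never leave C,
    yet it would have to end at b outside C. *)
Lemma not_inherent_of_trapped (P : sgraph) (v : path_graph l -> P) j :
    graph_iso v -> (exists q, induced_path q) ->
    (forall q, induced_path q -> trapped q j) ->
  ~ inherent (TwoRooted (v ord0) (v j)).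
Proof.
move=> [vbij vadj] [q0 [q0inj q0adj]] trap inh.
have [w vK wK] := vbij.
have contG : contains_induced G P.
  have q0S (x : P) : q0 (w x) \in [set q0 i | i : 'I_l.+1] by apply: imset_f.
  pose f (x : P) : induced [set q0 i | i : 'I_l.+1] := exist _ (q0 (w x)) (q0S x).
  exists [set q0 i | i : 'I_l.+1], f.
  split; last first.
    by move=> x y; rewrite /= /induced_adj /= q0adj -{2}(wK x) -{2}(wK y) vadj.
  apply: inj_card_bij => [x y [] /q0inj /(can_inj wK) //|].
  rewrite card_sig card_imset //= -(card_image (bij_inj vbij)).
  by apply: subset_leq_card; apply/subsetP.
have [H [f [[fbij fadj] fs ft]] avH] := inh G contG.
pose q i : G := val (f (v i)).
have qpath : induced_path q.
  split=> [i k /val_inj /(bij_inj fbij) /(bij_inj vbij) //|i k].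
  by rewrite -[path_adj i k]/(adj (i : path_graph l) k) -vadj -fadj.
have qS : rs_set H = [set q i | i : 'I_l.+1].
  apply/setP=> x; apply/idP/imsetP => [xS|[i _ ->]]; last exact: valP.
  have [g _ gK] := fbij; exists (w (g (exist _ x xS))) => //.
  by rewrite /q wK gK.
have [a [b [C [aq bq [ab abF] [Ca Cb] esc]]]] := trap q qpath.
pose S' := rs_set H :|: [set a; b].
have aS' : a \in S' by rewrite !inE eqxx orbT.
have bS' : b \in S' by rewrite !inE eqxx !orbT.
pose H' := @RootedSub G S' (exist _ a aS') (exist _ b bS').
have qs : val (rs_s H) = q ord0 by rewrite /q fs.
have qt : val (rs_t H) = q j by rewrite /q ft.
have notS c k : root_nbr q k c -> c \notin rs_set H.
  by move=> cq; rewrite qS; apply/imsetP=> -[i _ /eqP]; rewrite (cq i).1.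
have extH : is_extension H H'.
  have nbr c k (x : induced S') : root_nbr q k c ->
      adj c a = false -> adj c b = false -> (a == q k) = false ->
      (b == q k) = false -> adj c (val x) = (val x == q k).
    move=> cq ca cb aqk bqk; have := valP x; rewrite !inE qS.
    case/or3P=> [/imsetP[i _ ->]|/eqP->|/eqP->]; last 2 first.
    - by rewrite ca aqk.
    - by rewrite cb bqk.
    by rewrite (cq i).2 (inj_eq qpath.1).
  split=> //=.
  - by split; [exact: notS aq | exact: notS bq].
  - move=> x; rewrite /induced_adj /= qs.
    by apply: nbr; rewrite ?adj_irrefl ?(aq _).1 ?(bq _).1.
  - move=> x; rewrite /induced_adj /= qt.
    by apply: nbr; rewrite ?adj_irrefl ?(aq _).1 ?(bq _).1 // adj_sym.
have [n [Q [p [[_ padj] pa pb pint]]]] := avH H' extH.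
have Cp m (lt_m : m < n.+1) : C (val (p (Ordinal lt_m))).
  elim: m lt_m => [|m IHm] lt_m.
    rewrite (_ : Ordinal lt_m = ord0) ?pa //; exact: val_inj.
  have := esc _ _ (IHm (ltnW lt_m)).
  move/(_ (val (p (Ordinal lt_m)))).
  rewrite -[adj _ _]/(adj (p (Ordinal (ltnW lt_m))) (p (Ordinal lt_m))) padj /=.
  rewrite /path_adj /= eqxx => /(_ isT) /andP[neb /orP[//|yN]].
  (* The vertex reached is not b, hence not the last one; being internal, it must avoid the
     neighbourhood, a contradiction. *)
  have ltmn : m.+1 < n.
    rewrite ltn_neqAle -ltnS lt_m andbT; apply: contra neb => /eqP mn.
    by rewrite (_ : Ordinal lt_m = ord_max) ?pb //; apply: val_inj.
  by have := pint (Ordinal lt_m) ltmn; rewrite qS yN.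
by have := Cp n (ltnSn n); rewrite -[Ordinal _]/ord_max pb /= (negPf Cb).
Qed.

End Criterion.

(** * Finite check for a listed graph *)

Section Check.
Variables (G : sgraph) (vs : seq G).
Hypothesis vsE : forall x, x \in vs.
Implicit Types (s : seq G) (a b x y : G).

Definition extends x s : bool :=
  (x \notin s) && ([seq adj x y | y <- s] == [seq k == 0 | k <- iota 0 (size s)]).

Fixpoint induced_paths m : seq (seq G) :=
  if m is m'.+1 then
    [seq x :: s | s <- induced_paths m', x <- [seq x <- vs | extends x s]]
  else [:: [::]].

(** Completeness of the enumeration. Lists grow at the front, so the induction splits off [q 0] and
    shifts q by one; a map on [nat] permits this shift. *)
Lemma mem_induced_paths m (q : nat -> G) :
    {in gtn m &, injective q} ->
    {in gtn m &, forall i k, adj (q i) (q k) = (i.+1 == k) || (k.+1 == i)} ->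
  [seq q i | i <- iota 0 m] \in induced_paths m.
Proof.
elim: m q => [|m IHm] q qinj qadj //=.
rewrite -[1]addn0 iotaDl -map_comp.
apply/allpairsPdep; exists (map (q \o addn 1) (iota 0 m)), (q 0); split => //.
- apply: IHm => [i k im km /qinj /= eq|i k im km].
    by have := eq im km => -[].
  by rewrite qadj.
rewrite mem_filter vsE andbT; apply/andP; split.
  apply/mapP=> -[i]; rewrite mem_iota => im /qinj eq.
  by have /eq : 0 \in gtn m.+1 by []; move/(_ im).
rewrite size_map size_iota -map_comp; apply/eqP/eq_in_map => i.
rewrite mem_iota => im; rewrite /= qadj // eq_sym orbF.
by rewrite eqSS eq_sym.
Qed.

Definition near s y : bool := has (fun x => (x == y) || adj x y) s.

(* A certificate C for [trapped]; radius one around a is large enough for the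
   Petersen and Heawood graphs. *)
Definition trap s a : pred G := fun x => (x == a) || adj a x && ~~ near s x.

Definition root_nbrs s j : seq G :=
  [seq a <- vs | (a \notin s) &&
    ([seq adj a x | x <- s] == [seq k == j | k <- iota 0 (size s)])].

Definition has_trap j s : bool :=
  has (fun a => has (fun b =>
      [&& a != b, ~~ adj a b &
        all (fun x => all (fun y => (y != b) && (trap s a y || near s y))
                          [seq y <- vs | adj x y])
            [seq x <- vs | trap s a x]])
    (root_nbrs s j)) (root_nbrs s 0).

Lemma trapped_of_check l (j : 'I_l.+1) :
    all (has_trap j) (induced_paths l.+1) ->
  forall q : 'I_l.+1 -> G, induced_path q -> trapped q j.
Proof.
move=> chk q [qinj qadj].
(* [inord] extends q to all naturals; only arguments below l+1 occur. *)
pose s := [seq q (inord i) | i <- iota 0 l.+1].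
have sizes : size s = l.+1 by rewrite size_map size_iota.
have nths i : nth (q i) s i = q i.
  by rewrite (nth_map 0) ?size_iota // nth_iota // add0n inord_val.
have sP x : reflect (exists i, x = q i) (x \in s).
  apply: (iffP mapP) => [[i _ ->]|[i ->]]; first by exists (inord i).
  by exists (i : nat); rewrite ?inord_val // mem_iota /=.
have nearE y : near s y = (y \in path_nbhd q).
  apply/hasP/path_nbhdP => [[x /sP[i ->] h]|[i h]]; first by exists i.
  by exists (q i) => //; apply/sP; exists i.
have rootP (k : 'I_l.+1) a : a \in root_nbrs s k -> root_nbr q k a.
  rewrite mem_filter => /andP[/andP[/sP aS /eqP arow] _] i; split.
    by apply/eqP=> ai; apply: aS; exists i.
  rewrite -{1}(nths i) -(nth_map (q i) false (adj a)) ?sizes // arow sizes.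
  by rewrite (nth_map 0) ?size_iota // nth_iota.
have : s \in induced_paths l.+1.
  apply: (mem_induced_paths (q := fun i => q (inord i))) => i k im km.
    by move/qinj/(congr1 val); rewrite /= !inordK.
  by rewrite qadj /path_adj !inordK.
move/(allP chk)/hasP=> [a /(rootP ord0) aq /hasP[b /rootP bq /and3P[ab abF esc]]].
exists a, b, (trap s a); split=> //.
- by rewrite (negPf abF).
- by rewrite /trap eqxx eq_sym (negPf ab) (negPf abF).
move=> x y xC xy; rewrite -nearE.
have /allP/(_ x) := esc; rewrite mem_filter xC vsE => /(_ isT) /allP/(_ y).
by rewrite mem_filter xy vsE => /(_ isT).
Qed.

(** Soundness of the enumeration, by which a nonempty list yields an induced path in G. *)
Lemma induced_pathsP x0 m s :
    s \in induced_paths m ->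
  [/\ size s = m, uniq s &
      {in gtn m &, forall i k,
        adj (nth x0 s i) (nth x0 s k) = (i.+1 == k) || (k.+1 == i)}].
Proof.
elim: m s => [|m IHm] s /=; first by rewrite inE => /eqP->.
case/allpairsPdep=> s' [x [/IHm[size_s' uniq_s' adj_s']]].
rewrite mem_filter vsE andbT => /andP[xs' /eqP xrow] ->.
have adjx k : k < m -> adj x (nth x0 s' k) = (k == 0).
  move=> km; have := congr1 (nth false ^~ k) xrow.
  rewrite /= (nth_map x0) ?size_s' // (nth_map 0) ?size_iota //.
  by rewrite nth_iota.
split; rewrite /= ?size_s' ?xs' //.
case=> [|i] [|k] im km //=.
- exact: adj_irrefl.
- by rewrite adjx // eqSS eq_sym orbF.
- by rewrite adj_sym adjx // eqSS eq_sym.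
by rewrite adj_s' // !eqSS.
Qed.

Lemma not_inherent_of_check (P : sgraph) l (v : path_graph l -> P)
    (j : 'I_l.+1) :
    graph_iso v ->
    ~~ nilp (induced_paths l.+1) && all (has_trap j) (induced_paths l.+1) ->
  ~ inherent (TwoRooted (v ord0) (v j)).
Proof.
move=> viso /andP[ne chk]; apply: (@not_inherent_of_trapped G l) => //; last first.
  exact: trapped_of_check.
case def_s: (induced_paths l.+1) ne => [|s ss] // _.
have sP : s \in induced_paths l.+1 by rewrite def_s mem_head.
(* A listed path has l+1 vertices, so its head exists and can serve as the default of [nth]. *)
case: s sP {def_s} => [/allpairsPdep[? [? []]]//|x0 s sP].
have [size_s uniq_s adj_s] := induced_pathsP x0 sP.
exists (fun i => nth x0 (x0 :: s) i); split=> [i k /eqP|i k]; last first.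
  by apply: adj_s; apply: ltn_ord.
by rewrite nth_uniq ?size_s // => /eqP ik; apply: val_inj.
Qed.

End Check.

(** * The Petersen and Heawood graphs *)

Section OrdinalGraph.
Variables (n : nat) (r : rel nat).

(** Symmetrizing r lets each edge be given in one direction only. *)
Definition ord_adj : rel 'I_n.+1 := fun i k => (i != k) && (r i k || r k i).

Lemma ord_adj_sym : symmetric ord_adj.
Proof. by move=> i k; rewrite /ord_adj eq_sym orbC. Qed.

Lemma ord_adj_irrefl : irreflexive ord_adj.
Proof. by move=> i; rewrite /ord_adj eqxx. Qed.

Definition ord_graph : sgraph := SGraph ord_adj_sym ord_adj_irrefl.

(* Unlike [enum 'I_n.+1], this list can be evaluated by vm_compute. *)
Definition ords : seq ord_graph := [seq inZp i | i <- iota 0 n.+1].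

Lemma mem_ords i : i \in ords.
Proof.
by apply/mapP; exists (i : nat); rewrite ?valZpK // mem_iota /=.
Qed.

End OrdinalGraph.

(* Outer cycle 0, ..., 4, spokes i -- i + 5, and inner pentagram. *)
Definition petersen : sgraph :=
  ord_graph 9 (fun i k => if i < 5 then (k == i.+1 %% 5) || (k == i + 5)
                          else k == 5 + (i + 2) %% 5).

(* Hamiltonian cycle 0, ..., 13 with the chords i -- i + 5 for even i. *)
Definition heawood : sgraph :=
  ord_graph 13 (fun i k =>
    (k == i.+1 %% 14) || ~~ odd i && (k == (i + 5) %% 14)).

(** In the four checks the numerals are the number l+1 of path vertices and the position of t on the
    path. *)
Lemma petersen_trap2 :
  let ps := induced_paths (ords 9 _ : seq petersen) 3 in
  ~~ nilp ps && all (has_trap (ords _ _) 0) ps.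
Proof. by vm_compute. Qed.

Lemma petersen_trap3 :
  let ps := induced_paths (ords 9 _ : seq petersen) 4 in
  ~~ nilp ps && all (has_trap (ords _ _) 1) ps.
Proof. by vm_compute. Qed.

Lemma heawood_trap4 :
  let ps := induced_paths (ords 13 _ : seq heawood) 5 in
  ~~ nilp ps && all (has_trap (ords _ _) 1) ps.
Proof. by vm_compute. Qed.

Lemma heawood_trap5 :
  let ps := induced_paths (ords 13 _ : seq heawood) 6 in
  ~~ nilp ps && all (has_trap (ords _ _) 2) ps.
Proof. by vm_compute. Qed.

(** * The doubled cycle *)

Section DoubledCycle.
Variable l : nat.
Local Open Scope ring_scope.
Implicit Types (x y e : 'I_l.+3) (m n : nat).

(** The fibre reached from x after m steps around the cycle in direction e, which is 1 or -1. *)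
Definition coord x e m : 'I_l.+3 := x + m%:R * e.

Definition cycle_adj x y : bool := (y == x + 1) || (x == y + 1).

Lemma natr_cycle_eq m n :
  (m%:R == n%:R :> 'I_l.+3) = (m == n %[mod l.+3])%N.
Proof. by rewrite -val_eqE /= !Zp_nat. Qed.

Lemma coord0 x e : coord x e 0 = x.
Proof. by rewrite /coord mul0r addr0. Qed.

Lemma coordS x e m : coord x e m.+1 = coord x e m + e.
Proof. by rewrite /coord -natr1 mulrDl mul1r addrA. Qed.

Lemma coord_eq x e m n : e = 1 \/ e = -1 ->
  (coord x e m == coord x e n) = (m == n %[mod l.+3])%N.
Proof.
rewrite /coord -natr_cycle_eq (inj_eq (addrI x)) => -[] ->; rewrite ?mulr1 //.
by rewrite !mulrN1 (inj_eq oppr_inj).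
Qed.

Lemma coordP x e y : e = 1 \/ e = -1 ->
  exists2 m, (m < l.+3)%N & y = coord x e m.
Proof.
move=> eE; have ee : e * e = 1 by case: eE => ->; rewrite ?mulr1 ?mulrNN ?mulr1.
(* Since e is its own inverse, this solves x + m e = y for m. *)
exists ((y - x) * e : 'I_l.+3) => //.
by rewrite /coord Zp_nat valZpK -mulrA ee mulr1 addrC subrK.
Qed.

(** The last two disjuncts are the wrap-around edge. Adjacency thus becomes linear arithmetic on
    positions, within reach of [lia]. *)
Lemma cycle_adj_coord x e m n : e = 1 \/ e = -1 -> (m < l.+3)%N -> (n < l.+3)%N ->
  cycle_adj (coord x e m) (coord x e n) =
  [|| m.+1 == n, n.+1 == m, (m == 0) && (n == l.+2) | (n == 0) && (m == l.+2)]%N.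
Proof.
move=> eE lt_m lt_n.
have -> : cycle_adj (coord x e m) (coord x e n) =
    (n == m.+1 %[mod l.+3]) || (m == n.+1 %[mod l.+3]).
  rewrite -!(coord_eq x _ _ eE) !coordS /cycle_adj.
  case: eE => -> //; rewrite orbC.
  by rewrite ![_ == _ + -1]eq_sym !subr_eq.
have modS k : (k < l.+3)%N -> (k.+1 %% l.+3 = if k == l.+2 then 0 else k.+1)%N.
  move=> lt_k; case: eqP => [->|k_neq]; first exact: modnn.
  by rewrite modn_small //; lia.
rewrite !modS // !modn_small //.
by case: (m =P l.+2) => ?; case: (n =P l.+2) => ?; lia.
Qed.

Definition dcycle_adj : rel ('I_l.+3 * bool) := fun u w => cycle_adj u.1 w.1.

Lemma dcycle_adj_sym : symmetric dcycle_adj.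
Proof. by move=> u w; rewrite /dcycle_adj /cycle_adj orbC. Qed.

Lemma dcycle_adj_irrefl : irreflexive dcycle_adj.
Proof.
by move=> u; rewrite /dcycle_adj /cycle_adj orbb -subr_eq0 opprD addNKr oppr_eq0 oner_eq0.
Qed.

Definition dcycle : sgraph := SGraph dcycle_adj_sym dcycle_adj_irrefl.

Lemma ltn_ord_cycle (i : 'I_l.+1) : (i < l.+3)%N.
Proof. exact: leq_trans (ltn_ord i) (leqW (leqnSn _)). Qed.

Lemma dcycle_path : exists q : 'I_l.+1 -> dcycle, induced_path q.
Proof.
exists (fun i => (coord 0 1 i, false)); split=> [i k /(congr1 fst) /eqP|i k].
  rewrite coord_eq; last by left.
  by rewrite !modn_small ?ltn_ord_cycle // => /eqP/val_inj.
rewrite /= /dcycle_adj cycle_adj_coord ?ltn_ord_cycle //; last by left.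
rewrite /path_adj; case: i k => i /= ? [k /= ?]; lia.
Qed.

(** The first edge fixes the direction e; turning back later would put two path vertices into one
    fibre. *)
Lemma dcycle_path_coord (q : 'I_l.+1 -> dcycle) :
    (l != 2)%N -> (0 < l)%N -> induced_path q ->
  exists x e, [/\ e = 1 \/ e = -1 &
    forall i : 'I_l.+1, (q i).1 = coord x e i].
Proof.
move=> l2 l0 [qinj qadj].
(* Two path vertices in the same fibre are twins, which an induced path with
   other than two edges does not contain. *)
have fst_inj (i k : 'I_l.+1) : (q i).1 = (q k).1 -> i = k.
  move=> ik; have twin j : path_adj i j = path_adj k j.
    by rewrite -!qadj /= /dcycle_adj ik.
  apply: val_inj => /=; move: (twin i) (twin k).
  have tw j (lt_j : (j < l.+1)%N) := twin (Ordinal lt_j).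
  (* The vertex before the smaller index or after the larger one tells i and k apart. If they are
     the two ends, the vertex after the smaller does, as l is not 2. *)
  have := tw (minn i k).+1; have := tw (minn i k).-1; have := tw (maxn i k).+1.
  rewrite /path_adj /=; move: (ltn_ord i) (ltn_ord k).
  case: (ltngtP (i : nat) (k : nat)) => //; lia.
pose c i := (q (inord i)).1.
have cadj i k : cycle_adj (c i) (c k) = path_adj (inord i : 'I_l.+1) (inord k).
  by rewrite -qadj.
have [e eE c1] : exists2 e, e = 1 \/ e = -1 & c 1 = c 0 + e.
  have := cadj 0 1; rewrite /path_adj !inordK //= => /orP[]/eqP.
    by exists 1; [left|].
  by move->; exists (-1); [right|rewrite addrK].
exists (c 0), e; split=> // i.
(* Two consecutive positions are carried along because excluding a turn back refers to the last but
   one. *)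
suff H m : (m < l)%N -> c m = coord (c 0) e m /\ c m.+1 = coord (c 0) e m.+1.
  rewrite -[i in LHS]inord_val; case: i => -[|i] lt_i /=; first by rewrite coord0.
  by rewrite -(H i lt_i).2.
elim: m => [|m IHm] lt_m; first by rewrite coordS coord0.
have [cm cm1] := IHm (ltnW lt_m); split=> //.
have cm2 : cycle_adj (c m.+2) (c m.+1).
  by rewrite cadj /path_adj ?inordK ?eqxx ?orbT // ltnW.
have neq : c m.+2 != c m.
  apply/eqP => /fst_inj/(congr1 val); rewrite /= !inordK ?(ltnW lt_m) //; lia.
have {cm2} : (c m.+2 == c m.+1 + e) || (c m.+2 == c m.+1 - e).
  move: cm2; rewrite /cycle_adj -subr_eq eq_sym.
  by case: eE => ->; rewrite ?opprK // orbC.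
case/orP=> /eqP c2; first by rewrite c2 cm1 -coordS.
by case/eqP: neq; rewrite c2 cm1 cm coordS addrK.
Qed.

Lemma dcycle_trapped (q : 'I_l.+1 -> dcycle) (j : 'I_l.+1) :
    (l != 2)%N -> (0 < l)%N ->
    ((j == 0 :> nat) || (2 < l) && (j == l.-1 :> nat))%N ->
  induced_path q -> trapped q j.
Proof.
move=> l2 l0 jE qpath; have [x [e [eE qE]]] := dcycle_path_coord l2 l0 qpath.
have lt_ord := ltn_ord_cycle.
have eq_coord m n : (m < l.+3)%N -> (n < l.+3)%N ->
    (coord x e m == coord x e n) = (m == n).
  by move=> lt_m lt_n; rewrite coord_eq // !modn_small.
(* Both twins d are treated, since for t = v_0 they serve as a and b. *)
have a_nbr d : root_nbr q ord0 ((coord x e l.+2, d) : dcycle).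
  move=> i; rewrite -[_ == q i]/((_ == _) && _) /= /dcycle_adj /= qE.
  rewrite eq_coord ?cycle_adj_coord //; case: i => i /= lt_i.
  by split; rewrite -?val_eqE /=; lia.
suff [b [bq ab abF]] : exists b : dcycle, [/\ root_nbr q j b,
    ((coord x e l.+2, false) : dcycle) != b &
    adj ((coord x e l.+2, false) : dcycle) b = false].
  exists (coord x e l.+2, false), b, (pred1 ((coord x e l.+2, false) : dcycle)).
  split=> //; first by rewrite /= eqxx eq_sym.
  move=> u [y d] /eqP-> ay; apply/andP; split.
    by apply: contraFN abF => /eqP<-.
  apply/orP; right; apply/path_nbhdP.
  have [m lt_m yE] := coordP x y eE.
  move: ay; rewrite /= /dcycle_adj /= yE cycle_adj_coord // => m_eq.
  (* The neighbours of a lie in fibres 0 and l+1, where they are adjacent to v_1 and v_l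
     respectively. *)
  have [m0|m_neq0] := eqVneq m 0%N.
    exists (Ordinal (l0 : 1 < l.+1)%N); apply/orP; right.
    by rewrite /= qE cycle_adj_coord // m0.
  exists ord_max; apply/orP; right.
  by rewrite /= qE cycle_adj_coord //=; lia.
case/orP: jE => [/eqP j0|/andP[l3 /eqP jl]].
  exists (coord x e l.+2, true); split.
  - by rewrite (_ : j = ord0) //; apply: val_inj.
  - by rewrite -[_ == _]/((_ == _) && _) eqxx.
  by rewrite /= /dcycle_adj cycle_adj_coord //=; lia.
(* The twin of v_l shares its neighbours, and the only one on the path is v_(l-1). *)
exists ((q ord_max).1, ~~ (q ord_max).2); split.
- move=> i; split.
    have [->|neq] := eqVneq i ord_max.
      by case: (q _) => y [] ; rewrite -[_ == _]/((_ == _) && _) /= andbF.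
    rewrite -[_ == q i]/((_ == _) && _) /= !qE eq_coord //.
    by rewrite -[_ == _ :> nat]/(ord_max == i) eq_sym (negPf neq).
  transitivity (adj (q ord_max) (q i)) => //.
  rewrite qpath.2 /path_adj -(inj_eq val_inj) /= jl.
  by case: i => i /= lt_i; lia.
- by rewrite -[_ == _]/((_ == _) && _) /= qE eq_coord //=; lia.
by rewrite /= /dcycle_adj /= qE cycle_adj_coord //=; lia.
Qed.

End DoubledCycle.

Theorem theorem1p7 (P : sgraph) (l : nat) (v : path_graph l -> P)
    (hv : graph_iso v) (s t : P) (hs : s = v ord0)
    (ht : [\/ 1 <= l /\ t = v ord0,
              3 <= l /\ t = v (inord l.-1),
              l = 3 /\ t = v (inord 1)
            | l = 4 /\ t = v (inord 1) \/ l = 5 /\ t = v (inord 2)]) :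
  ~ inherent (TwoRooted s t).
Proof.
have doubled_cycle (j : 'I_l.+1) : l != 2 -> 0 < l ->
    (j == 0 :> nat) || (2 < l) && (j == l.-1 :> nat) ->
    ~ inherent (TwoRooted (v ord0) (v j)).
  move=> l2 l0 jE; apply: (not_inherent_of_trapped hv (dcycle_path l)).
  by move=> q; apply: dcycle_trapped.
rewrite {s}hs; case: ht => [[l0 ->]|[l3 ->]|[l3 tE]|[[l4 tE]|[l5 tE]]].
(* For l = 2 the two ends of a path in the doubled cycle may be twins, so the Petersen graph is used
   instead. *)
- have [l2|l2] := eqVneq l 2; last exact: doubled_cycle.
  subst l; apply: (not_inherent_of_check (@mem_ords 9 _) hv).
  exact: petersen_trap2.
- by apply: doubled_cycle; rewrite ?inordK //; lia.
- subst l t; apply: (not_inherent_of_check (@mem_ords 9 _) hv).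
  by rewrite inordK //; apply: petersen_trap3.
- subst l t; apply: (not_inherent_of_check (@mem_ords 13 _) hv).
  by rewrite inordK //; apply: heawood_trap4.
subst l t; apply: (not_inherent_of_check (@mem_ords 13 _) hv).
by rewrite inordK //; apply: heawood_trap5.
Qed.
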